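(* Let $n\ge 1$, $\sigma>0$, $\alpha\in(0,1)$, and let $\boldsymbol{\mu}\in\mathcal S_n^\uparrow$. Observe $\mathbf y=\boldsymbol\mu+\boldsymbol\xi$ with $\boldsymbol\xi\sim\mathcal N(\mathbf 0,\sigma^2 I_{n\times n})$. Let $\hat{\boldsymbol\mu}=\Pi_{\mathcal S_n^\uparrow}(\mathbf y)$ be the least squares estimator over $\mathcal S_n^\uparrow$, let $\hat k=k(\hat{\boldsymbol\mu})$, and define $$\hat r_\uparrow=\frac{\sigma^2\hat k\,\big(2+22\log n+10\log(1/\alpha)\big)}{n}.$$ Then with probability at least $1-\alpha$, $$\frac1n\sum_{i=1}^n(\hat\mu_i-\mu_i)^2\le \hat r_\uparrow .$$
   Context: $\mathcal S_n^\uparrow=\{\mathbf u\in\mathbb R^n: u_1\le u_2\le\dots\le u_n\}$ (the cone of nondecreasing sequences; $\mathcal S_1^\uparrow=\mathbb R$). $\Pi_K$ denotes the Euclidean projection onto a closed convex set $K$, so $\Pi_{\mathcal S_n^\uparrow}(\mathbf y)=\arg\min_{\mathbf u\in\mathcal S_n^\uparrow}\|\mathbf y-\mathbf u\|_2^2$. For $\mathbf u\in\mathbb R^n$, $k(\mathbf u)=|\{u_1,\dots,u_n\}|$ is the number of distinct values of $\mathbf u$; for a nondecreasing $\mathbf u$ it is the number of constant pieces (one plus the number of strict inequalities $u_i<u_{i+1}$). $\log$ is the natural logarithm. *)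

(* Defs.v *)
From HB Require Import structures.
From mathcomp Require Import all_boot all_order all_algebra.
From mathcomp Require Import all_classical all_reals all_analysis.
Set Implicit Arguments. Unset Strict Implicit. Unset Printing Implicit Defensive.
Import Order.TTheory GRing.Theory Num.Theory.
Local Open Scope classical_set_scope.
Local Open Scope ring_scope.

Definition nondecr {R : realType} {n : nat} (u : 'I_n -> R) : Prop :=
  forall i j : 'I_n, (i <= j)%N -> u i <= u j.

Definition sqdist {R : realType} {n : nat} (y u : 'I_n -> R) : R :=
  \sum_(i < n) (y i - u i) ^+ 2.

(* u = Pi_{S_n^up}(y): u is in the cone and minimizes ||y - u||^2 over it
   (the minimizer exists and is unique, the cone being closed and convex). *)
Definition is_iso_proj {R : realType} {n : nat} (y u : 'I_n -> R) : Prop :=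
  nondecr u /\ forall v : 'I_n -> R, nondecr v -> sqdist y u <= sqdist y v.

Definition nb_distinct {R : realType} {n : nat} (u : 'I_n -> R) : nat :=
  size (undup [seq u i | i <- enum 'I_n]).

Definition mutually_independent {R : realType} {d} {T : measurableType d}
  (P : probability T R) {n : nat} (X : 'I_n -> T -> R) : Prop :=
  forall B : 'I_n -> set R, (forall i, measurable (B i)) ->
    P (\bigcap_(i in [set: 'I_n]) (X i @^-1` B i)) =
    (\prod_(i < n) P (X i @^-1` B i))%E.

Definition has_normal_law {R : realType} {d} {T : measurableType d}
  (P : probability T R) (X : T -> R) (m s : R) : Prop :=
  forall B : set R, measurable B -> P (X @^-1` B) = normal_prob m s B.

(* Main.v *)
(* Fix a level set of [muhat], an interval on which [muhat] takes the value [c].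
   Moving [muhat] on this interval along a nondecreasing direction is admissible for
   small steps, so minimality makes the residual orthogonal to the constants and
   gives it a nonpositive inner product with [mu]. Since [mu] is deterministic, the
   vector [c - mu] restricted to the interval lies in a fixed two-dimensional space,
   and its squared norm is at most the sum of the squares of two normalized Gaussian
   linear forms in the noise: along the constants, and along the centred [mu].
   The Chernoff bound for these forms, a union bound over the intervals [a, b], and
   a summation over the levels of [muhat] conclude. *)

Require Import Defs.
From HB Require Import structures.
From mathcomp Require Import all_boot all_order all_algebra.
From mathcomp Require Import all_classical all_reals all_analysis.
From mathcomp Require Import measurable_realfun ring lra.
Set Implicit Arguments. Unset Strict Implicit. Unset Printing Implicit Defensive.
Import Order.TTheory GRing.Theory Num.Theory.
Local Open Scope classical_set_scope.
Local Open Scope ring_scope.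

(** * Weighted integrals and the image measure that determines them *)

Section weighted_integral.
Context {R : realType} {dT : measure_display} {T : measurableType dT}
  {dY : measure_display} {Y : measurableType dY}
  (m : {measure set T -> \bar R}) (X : T -> Y) (G : T -> R).
Hypotheses (mX : measurable_fun [set: T] X) (mG : measurable_fun [set: T] G)
  (G0 : forall x, 0 <= G x).
Import HBNNSimple.

Lemma weighted_integral_nnsfun (h : {nnsfun Y >-> R}) :
  (\int[m]_x (G x * h (X x))%:E =
   \sum_(r \in range h)
     r%:E * \int[m]_(x in X @^-1` (h @^-1` [set r])) (G x)%:E)%E.
Proof.
have mXh r : measurable (X @^-1` (h @^-1` [set r])).
  by rewrite -[X in measurable X]setTI; exact: mX.
transitivity (\int[m]_x
    (\sum_(r \in range h) (G x * (r * \1_(h @^-1` [set r]) (X x)))%:E))%E.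
  apply: eq_integral => x _; rewrite fsumEFin//; congr EFin.
  by rewrite [in LHS](fimfunE h (X x)) fsbig_distrr.
have mi r : measurable_fun [set: T] (fun x => \1_(h @^-1` [set r]) (X x) : R).
  exact: measurableT_comp.
rewrite ge0_integral_fsum//; last 2 first.
  - by move=> r; apply/measurable_EFinP/measurable_funM => //;
      exact: measurable_funM.
  - by move=> r x _; rewrite EFinM mule_ge0 ?lee_fin// -lee_fin EFinM
      nnfun_muleindic_ge0.
apply: eq_fsbigr => r /set_mem[y _ <-{r}].
have hy0 : 0 <= h y by [].
under eq_integral do rewrite mulrCA EFinM.
rewrite ge0_integralZl//; last 2 first.
  - by apply/measurable_EFinP/measurable_funM.
  - by move=> x _; rewrite lee_fin mulr_ge0.
congr (_ * _)%E; rewrite [RHS]integral_mkcond; apply: eq_integral => x _.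
rewrite patchE indicE; case: (asboolP (h (X x) = h y)) => hX.
  by rewrite !mem_set//= mulr1.
by rewrite !memNset//= mulr0.
Qed.

Lemma weighted_integral_lim (f : Y -> R) (mf : measurable_fun [set: Y] (EFin \o f)) :
  (forall y, 0 <= f y) ->
  (\int[m]_x (G x * f (X x))%:E =
   limn (fun k => \int[m]_x (G x * nnsfun_approx measurableT mf k (X x))%:E))%E.
Proof.
move=> f0; set h := nnsfun_approx measurableT mf.
rewrite -monotone_convergence//=.
- apply: eq_integral => x _; apply/esym/cvg_lim => //=.
  have /= := @cvg_nnsfun_approx _ _ _ _ measurableT _ mf
    (fun y _ => f0 y : (0 <= (f y)%:E)%E) (X x) I.
  move=> /(cvgeZl (y := (G x)%:E) erefl); rewrite -EFinM; apply: cvg_trans.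
  by apply: near_eq_cvg; apply: nearW => k /=; rewrite EFinM.
- move=> k; apply/measurable_EFinP/measurable_funM => //.
  exact: measurableT_comp.
- by move=> k x _; rewrite lee_fin mulr_ge0.
- move=> x _ a b ab; rewrite lee_fin; apply: ler_wpM2l => //.
  exact/lefP/nd_nnsfun_approx.
Qed.

End weighted_integral.

Section weighted_integral_eq.
Import HBNNSimple.

(** Such an integral depends only on the image under [X] of the measure with density [G]. This is
    clear for simple [f], and monotone convergence extends it. It serves both to pass from [P] to
    Lebesgue measure with a normal density and to replace independent factors by their mean. *)
Lemma weighted_integral_eq {R : realType} {d1 d2 dY : measure_display}
  {T1 : measurableType d1} {T2 : measurableType d2} {Y : measurableType dY}
  (m1 : {measure set T1 -> \bar R}) (m2 : {measure set T2 -> \bar R})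
  (X1 : T1 -> Y) (X2 : T2 -> Y) (G1 : T1 -> R) (G2 : T2 -> R) (f : Y -> R) :
  measurable_fun [set: T1] X1 -> measurable_fun [set: T2] X2 ->
  measurable_fun [set: T1] G1 -> measurable_fun [set: T2] G2 ->
  measurable_fun [set: Y] f ->
  (forall x, 0 <= G1 x) -> (forall x, 0 <= G2 x) -> (forall y, 0 <= f y) ->
  (forall B, measurable B ->
    (\int[m1]_(x in X1 @^-1` B) (G1 x)%:E =
     \int[m2]_(x in X2 @^-1` B) (G2 x)%:E)%E) ->
  (\int[m1]_x (G1 x * f (X1 x))%:E = \int[m2]_x (G2 x * f (X2 x))%:E)%E.
Proof.
move=> mX1 mX2 mG1 mG2 /measurable_EFinP mf G10 G20 f0 eqG.
rewrite (weighted_integral_lim m1 mX1 mG1 G10 mf f0).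
rewrite (weighted_integral_lim m2 mX2 mG2 G20 mf f0); congr (limn _).
apply/funext => k; rewrite !weighted_integral_nnsfun//.
by apply: eq_fsbigr => r _; rewrite eqG//; exact: measurable_funPTI.
Qed.

End weighted_integral_eq.

(** * Independence, from events to products of nonnegative functions *)

Section independence.
Context {R : realType} {d : measure_display} {T : measurableType d}
  (P : probability T R) {n : nat} (X : 'I_n -> T -> R).
Hypotheses (mX : forall i, measurable_fun [set: T] (X i))
  (indepX : mutually_independent P X).

Lemma mutually_independent_integral_indic (B : 'I_n -> set R) :
  (forall i, measurable (B i)) ->
  (\int[P]_w (\prod_i \1_(B i) (X i w))%:E =
   \prod_i \int[P]_w (\1_(B i) (X i w))%:E)%E.
Proof.
move=> mB; have mXB i : measurable (X i @^-1` B i).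
  by rewrite -[Y in measurable Y]setTI; exact: mX.
have -> : (\prod_i \int[P]_w (\1_(B i) (X i w))%:E =
           \prod_i P (X i @^-1` B i))%E.
  apply: eq_bigr => i _; rewrite -[in RHS](setIT (X i @^-1` B i)).
  by rewrite -integral_indic.
rewrite -indepX// -[X in P X]setIT -integral_indic//; last first.
  by apply: fin_bigcap_measurable.
apply: eq_integral => w _; congr EFin; rewrite [RHS]indicE.
case: (pselect (forall i, B i (X i w))) => [Bw|/existsNP[i Bw]].
  rewrite mem_set/=; last by move=> i _; exact: Bw.
  apply: big1 => i _.
  by rewrite indicE mem_set//; exact: Bw.
rewrite memNset; last by move=> /(_ i I).
by rewrite (bigD1 i)//= indicE memNset// mul0r.
Qed.

Lemma mutually_independent_integral_prod (f : 'I_n -> R -> R) (c : 'I_n -> R) :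
  (forall i, measurable_fun [set: R] (f i)) -> (forall i x, 0 <= f i x) ->
  (forall i, (\int[P]_w (f i (X i w))%:E = (c i)%:E)%E) ->
  (\int[P]_w (\prod_i f i (X i w))%:E = (\prod_i c i)%:E)%E.
Proof.
(* The factors of index at least [k] are indicators; the product rule is
   extended to arbitrary factors one index at a time. *)
suff prod_rule k : forall (g : 'I_n -> R -> R) (b : 'I_n -> R),
    (forall i, measurable_fun [set: R] (g i)) -> (forall i x, 0 <= g i x) ->
    (forall i, (\int[P]_w (g i (X i w))%:E = (b i)%:E)%E) ->
    (forall i : 'I_n, (k <= i)%N -> exists2 B, measurable B & g i = \1_B) ->
    (\int[P]_w (\prod_i g i (X i w))%:E = (\prod_i b i)%:E)%E.
  move=> mf f0 fc; apply: (prod_rule n) => // i.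
  by rewrite leqNgt ltn_ord.
elim: k => [|k IHk] g b mg g0 gb gB.
  pose B i := s2val (cid2 (gB i (leq0n i))).
  have gE i : g i = \1_(B i) by exact: s2valP' (cid2 (gB i (leq0n i))).
  under eq_integral do under eq_bigr do rewrite gE.
  rewrite mutually_independent_integral_indic; last first.
    by move=> i; exact: s2valP (cid2 (gB i (leq0n i))).
  by rewrite -prodEFin; apply: eq_bigr => i _; rewrite -gb gE.
have [nk|kn] := leqP n k.
  by apply: IHk => // i; rewrite leqNgt (leq_trans (ltn_ord i)).
pose i0 := Ordinal kn.
pose G w := \prod_(i | i != i0) g i (X i w).
pose C := \prod_(i | i != i0) b i.
have mgX i : measurable_fun [set: T] (fun w => g i (X i w)).
  exact: measurableT_comp (mg i) (mX i).
have mG : measurable_fun [set: T] G.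
  rewrite /G; under eq_fun do rewrite -big_filter.
  exact: measurable_prod.
have G0 w : 0 <= G w by exact: prodr_ge0.
have b0 i : 0 <= b i.
  by rewrite -lee_fin -gb; apply: integral_ge0 => w _; rewrite lee_fin.
have C0 : 0 <= C by exact: prodr_ge0.
under eq_integral do rewrite (bigD1 i0)//= mulrC.
rewrite (@weighted_integral_eq _ _ _ _ _ _ _ P P (X i0) (X i0) G (cst C))//.
- under eq_integral do rewrite /= EFinM.
  rewrite ge0_integralZl//=; last 2 first.
  + exact/measurable_EFinP.
  + by move=> w _; rewrite lee_fin.
  by rewrite gb -EFinM (bigD1 i0)//= mulrC.
move=> B mB.
have mXB : measurable (X i0 @^-1` B).
  by rewrite -[Y in measurable Y]setTI; exact: mX.
transitivity (C%:E * P (X i0 @^-1` B))%E; last by rewrite -integral_cst.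
(* With an indicator at index [k], the induction hypothesis applies and computes the integral of [G]
   over the event. *)
pose g' i := if i == i0 then \1_B else g i.
pose b' i := if i == i0 then fine (P (X i0 @^-1` B)) else b i.
have /= := IHk g' b'.
rewrite (bigD1 i0)//= /b' eqxx EFinM fineK ?fin_num_measure// muleC.
rewrite (eq_bigr b) => [<-|i /negbTE->]//.
- rewrite [LHS]integral_mkcond; apply: eq_integral => w _.
  rewrite (bigD1 i0)//= (eq_bigr (fun i => g i (X i w))); last first.
    by move=> i /negbTE ii0; rewrite /g' ii0.
  rewrite patchE /g' eqxx indicE; case: (asboolP (B (X i0 w))) => BX.
    by rewrite !mem_set//= mul1r.
  by rewrite !memNset//= mul0r.
- by move=> i; rewrite /g'; case: eqP.
- by move=> i x; rewrite /g'; case: eqP.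
- move=> i; rewrite /g'; case: eqP => [->|_]; last exact: gb.
  by rewrite fineK ?fin_num_measure// -[in RHS](setIT (X i0 @^-1` B)) -integral_indic.
- move=> i ki; rewrite /g'; case: eqP => [_|/eqP ii0]; first by exists B.
  by apply: gB; rewrite ltn_neqAle ki andbT eq_sym; exact: ii0.
Qed.

End independence.

(** * Moment generating function and tails of Gaussian linear forms *)

Section gaussian_linear_forms.
Context {R : realType} {d : measure_display} {T : measurableType d}
  (P : probability T R).

Lemma normal_law_mgf (X : T -> R) (s t : R) : s != 0 ->
  measurable_fun [set: T] X -> has_normal_law P X 0 s ->
  (\int[P]_w (expR (t * X w))%:E = (expR (t ^+ 2 * s ^+ 2 / 2))%:E)%E.
Proof.
move=> s0 mX XN.
transitivity (\int[lebesgue_measure]_x (normal_pdf 0 s x * expR (t * x))%:E)%E.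
  under eq_integral do rewrite -[expR _]mul1r.
  apply: (@weighted_integral_eq _ _ _ _ _ (measurableTypeR R) (measurableTypeR R)
    P lebesgue_measure X id (cst 1) (normal_pdf 0 s) (fun x => expR (t * x))) => //.
  - exact: measurable_normal_pdf.
  - by apply: measurableT_comp => //; exact: measurable_funM.
  - by move=> x; exact: normal_pdf_ge0.
  - move=> B mB; transitivity (1%:E * P (X @^-1` B))%E.
      rewrite -integral_cst//.
      by rewrite -[Y in measurable Y]setTI; exact: mX.
    by rewrite mul1e XN.
(* Completing the square: exponential tilting by [t] moves the mean to [t * s ^+ 2], and the
   remaining density integrates to 1. *)
have shift x : normal_pdf 0 s x * expR (t * x) =
    expR (t ^+ 2 * s ^+ 2 / 2) * normal_pdf (t * s ^+ 2) s x.
  rewrite !normal_pdfE// /normal_fun [RHS]mulrCA -[LHS]mulrA -!expRD.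
  congr (_ * expR _).
  by rewrite -[s ^+ 2 *+ 2]mulr_natr; field.
under eq_integral do rewrite shift EFinM.
rewrite ge0_integralZl ?lee_fin ?expR_ge0//.
- by rewrite integral_normal_pdf mule1.
- by apply/measurable_EFinP; exact: measurable_normal_pdf.
- by move=> x _; rewrite lee_fin normal_pdf_ge0.
Qed.

Context {n : nat} (X : 'I_n -> T -> R) (s : R).
Hypotheses (mX : forall i, measurable_fun [set: T] (X i))
  (indepX : mutually_independent P X) (s_gt0 : 0 < s)
  (normalX : forall i, has_normal_law P (X i) 0 s).

Lemma measurable_linear_form (a : 'I_n -> R) :
  measurable_fun [set: T] (fun w => \sum_i a i * X i w).
Proof. by apply: measurable_sum => i; exact: measurable_funM. Qed.

Lemma measurable_linear_form_ge (a : 'I_n -> R) (x : R) :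
  measurable [set w | x <= \sum_i a i * X i w].
Proof.
have -> : [set w | x <= \sum_i a i * X i w] =
    [set: T] `&` (fun w => \sum_i a i * X i w) @^-1` `[x, +oo[.
  by apply/seteqP; split => w; rewrite /= in_itv/= andbT // => -[].
exact: measurable_linear_form.
Qed.

Lemma measurable_linear_form_sqr_gt (a : 'I_n -> R) (x : R) :
  measurable [set w | x < (\sum_i a i * X i w) ^+ 2].
Proof.
have -> : [set w | x < (\sum_i a i * X i w) ^+ 2] =
    [set: T] `&` (fun w => (\sum_i a i * X i w) ^+ 2) @^-1` `]x, +oo[.
  by apply/seteqP; split => w; rewrite /= in_itv/= andbT // => -[].
by apply: measurable_funX => //; exact: measurable_linear_form.
Qed.

Lemma gaussian_linear_form_mgf (a : 'I_n -> R) (t : R) :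
  (\int[P]_w (expR (t * \sum_i a i * X i w))%:E =
   (expR (t ^+ 2 * s ^+ 2 * (\sum_i a i ^+ 2) / 2))%:E)%E.
Proof.
transitivity (\int[P]_w (\prod_i expR (t * a i * X i w))%:E)%E.
  apply: eq_integral => w _; rewrite -expR_sum mulr_sumr.
  by under eq_bigr do rewrite mulrA.
rewrite (mutually_independent_integral_prod mX indepX
  (f := fun i x => expR (t * a i * x))
  (c := fun i => expR ((t * a i) ^+ 2 * s ^+ 2 / 2))).
- rewrite -expR_sum; congr (expR _)%:E.
  by rewrite mulr_sumr mulr_suml; apply: eq_bigr => i _; ring.
- by move=> i; apply: measurableT_comp => //; exact: measurable_funM.
- by move=> i x; exact: expR_ge0.
- by move=> i; apply: normal_law_mgf => //; rewrite gt_eqF.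
Qed.

Lemma gaussian_linear_form_chernoff (a : 'I_n -> R) (t x : R) : 0 <= t ->
  (P [set w | x <= \sum_i a i * X i w]%R <=
   (expR (t ^+ 2 * s ^+ 2 * (\sum_i a i ^+ 2) / 2 - t * x))%:E)%E.
Proof.
move=> t0; have mY := measurable_linear_form a.
set S := [set w | _].
have mS : measurable S by exact: measurable_linear_form_ge.
rewrite -[S]setIT -integral_indic// expRD mulrC EFinM.
rewrite -gaussian_linear_form_mgf -ge0_integralZl//; last first.
  apply/measurable_EFinP; apply: measurableT_comp => //.
  exact: measurable_funM.
apply: ge0_le_integral => //.
- exact/measurable_EFinP.
- apply/measurable_EFinP; apply: measurable_funM => //.
  by apply: measurableT_comp => //; exact: measurable_funM.
(* Markov's inequality pointwise: on [S] the exponent [t * (Y - x)] is nonnegative, where [Y] is the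
   linear form. *)
- move=> w _; rewrite -EFinM lee_fin -expRD indicE.
  have [/set_mem xY|_] := boolP (w \in S); last exact: expR_ge0.
  rewrite -expR0 ler_expR addrC subr_ge0.
  exact: ler_wpM2l.
Qed.

Lemma gaussian_linear_form_tail (a : 'I_n -> R) (u : R) :
  (P [set w | u * s ^+ 2 * (\sum_i a i ^+ 2) < (\sum_i a i * X i w) ^+ 2]%R <=
   (2 * expR (- (u / 2)))%:E)%E.
Proof.
set A := \sum_i a i ^+ 2.
have mS : measurable [set w | u * s ^+ 2 * A < (\sum_i a i * X i w) ^+ 2].
  exact: measurable_linear_form_sqr_gt.
have A_ge0 : 0 <= A by apply: sumr_ge0 => i _; exact: sqr_ge0.
have [A0|A_neq0] := eqVneq A 0.
  rewrite [Y in P Y](_ : _ = set0) ?measure0 ?lee_fin ?mulr_ge0 ?expR_ge0//.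
  apply/seteqP; split => // w; rewrite /= big1 ?A0 ?mulr0 ?expr0n ?ltxx// => i _.
  have /eqP := A0; rewrite psumr_eq0 => [/allP/(_ i)|j _]; last exact: sqr_ge0.
  by rewrite mem_index_enum sqrf_eq0 => /(_ isT)/eqP ->; rewrite mul0r.
have {A_neq0 A_ge0}A_gt0 : 0 < A by rewrite lt_neqAle eq_sym A_neq0.
have [u0|u0] := leP u 0.
  apply: (le_trans (probability_le1 _ mS)); rewrite lee_fin.
  have : expR 0 <= expR (- (u / 2)) by rewrite ler_expR oppr_ge0; nra.
  rewrite expR0; lra.
(* This [t] minimizes the Chernoff exponent [t ^+ 2 * s ^+ 2 * A / 2 - t * x]. *)
pose x := Num.sqrt (u * s ^+ 2 * A); pose t := x / (s ^+ 2 * A).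
have xx : x ^+ 2 = u * s ^+ 2 * A.
  by rewrite sqr_sqrtr// !mulr_ge0 ?sqr_ge0 ?ltW.
have x0 : 0 <= x by exact: sqrtr_ge0.
have t0 : 0 <= t by rewrite mulr_ge0// invr_ge0 mulr_ge0 ?sqr_ge0// ltW.
have rate : t ^+ 2 * s ^+ 2 * A / 2 - t * x = - (u / 2).
  rewrite /t; transitivity (- (x ^+ 2) / (2 * (s ^+ 2 * A))).
    by field; rewrite !gt_eqF.
  by rewrite xx; field; rewrite !gt_eqF.
have AN : \sum_i (- a i) ^+ 2 = A by apply: eq_bigr => i _; rewrite sqrrN.
have mh := measurable_linear_form_ge.
apply: (@le_trans _ _ (P ([set w | x <= \sum_i a i * X i w] `|`
                          [set w | x <= \sum_i (- a i) * X i w]))).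
  apply: le_measure; rewrite ?inE//; first exact: measurableU.
  move=> w /=; rewrite -xx => xY.
  have : x <= `|\sum_i a i * X i w|.
    by rewrite -ler_sqr ?nnegrE// real_normK ?num_real// ltW.
  rewrite ler_normr => /orP[|]; [by left|right].
  by under eq_bigr do rewrite mulNr; rewrite sumrN.
apply: (le_trans (measureU2 _ _ _)) => //.
rewrite mulrDl !mul1r EFinD -rate; apply: leeD.
  exact: gaussian_linear_form_chernoff.
by rewrite -AN; exact: gaussian_linear_form_chernoff.
Qed.

End gaussian_linear_forms.

(** * First-order conditions and level sets of the isotonic fit *)

Section isotonic_projection.
Context {R : realType} {n : nat}.
Implicit Types y u v w mu xi : 'I_n -> R.

(** Within the level the order is kept because [w] is nondecreasing. Across levels there are
    finitely many strict gaps, and a small enough step closes none of them. *)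
Lemma nondecr_perturb_level u w c :
  nondecr u -> nondecr w ->
  \forall e \near 0^'+, nondecr (fun i => u i + (if u i == c then e * w i else 0)).
Proof.
move=> ndu ndw.
have gap : \forall e \near (0 : R)^'+, forall ij : 'I_n * 'I_n,
    u ij.1 < u ij.2 -> e * (`|w ij.1| + `|w ij.2|) <= u ij.2 - u ij.1.
  apply: filter_forall => -[i j] /=.
  have [uij|] := ltP (u i) (u j); last by move=> _; exact: nearW.
  (* The [+ 1] keeps the denominator positive when [w] vanishes at both indices. *)
  have w1 : 0 < `|w i| + `|w j| + 1 by rewrite ltr_wpDl ?addr_ge0.
  near=> e => _.
  have e0 : 0 < e by near: e; exact: nbhs_right_gt.
  have : e < (u j - u i) / (`|w i| + `|w j| + 1).
    by near: e; apply: nbhs_right_lt; rewrite divr_gt0 ?subr_gt0.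
  rewrite ltr_pdivlMr// => /ltW; apply: le_trans; rewrite ler_pM2l//.
  by rewrite lerDl ler01.
near=> e => i j ij.
have e0 : 0 < e by near: e; exact: nbhs_right_gt.
have ewij : e * w i <= e * w j by rewrite ler_pM2l//; exact: ndw.
have := ndu _ _ ij; rewrite le_eqVlt => /orP[/eqP <-|uij].
  by case: ifP => _; [rewrite lerD2l|].
have : e * (`|w i| + `|w j|) <= u j - u i.
  by move: uij; apply: (near gap e _ (i, j)).
have := ler_norm (e * w i); have := ler_norm (- (e * w j)); rewrite normrN.
have := normr_ge0 (e * w i); have := normr_ge0 (e * w j).
rewrite mulrDr !normrM !(gtr0_norm e0).
by case: ifP => _; case: ifP => _; lra.
Unshelve. all: by end_near.
Qed.

(** Along the perturbation the squared distance changes by [- 2 * e * S + e ^+ 2 * Q]. If [S] were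
    positive, this would be negative for small [e], against minimality. *)
Lemma iso_proj_level_le0 y u w c : is_iso_proj y u -> nondecr w ->
  \sum_(i | u i == c) (y i - c) * w i <= 0.
Proof.
move=> [ndu umin] ndw; set S := \sum_(i | _) _; rewrite leNgt; apply/negP => S0.
pose Q := \sum_(i | u i == c) w i ^+ 2.
have Q0 : 0 <= Q by apply: sumr_ge0 => i _; exact: sqr_ge0.
have := nondecr_perturb_level c ndu ndw.
have expand e : sqdist y (fun i => u i + (if u i == c then e * w i else 0)) =
    sqdist y u - 2 * e * S + e ^+ 2 * Q.
  rewrite /sqdist /S /Q !mulr_sumr [X in _ - X]big_mkcond [X in _ + X]big_mkcond.
  rewrite -sumrB -big_split/=; apply: eq_bigr => i _.
  by case: eqP => [->|_]; ring.
move=> near_nd; suff : \forall e \near (0 : R)^'+, False by move=> /filter_ex[].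
near=> e.
have e0 : 0 < e by near: e; exact: nbhs_right_gt.
have : e < S / (Q + 1).
  by near: e; apply: nbhs_right_lt; rewrite divr_gt0// ltr_wpDl.
rewrite ltr_pdivlMr ?ltr_wpDl// => eQ.
have nd_e := near near_nd e.
have : sqdist y u <= sqdist y u - 2 * e * S + e ^+ 2 * Q.
  by rewrite -expand; apply/umin/nd_e.
have : e * (e * (Q + 1)) < e * S by rewrite ltr_pM2l.
have := mulr_gt0 e0 S0; have := sqr_ge0 e.
rewrite mulrDr mulr1 mulrDr mulrA -!expr2.
lra.
Unshelve. all: by end_near.
Qed.

(** This places the random level sets within a fixed family of [n ^ 2] index pairs, as the union
    bound requires. *)
Lemma nondecr_level_interval u i0 : nondecr u ->
  exists a b : 'I_n, forall i, (u i == u i0) = (a <= i <= b)%N.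
Proof.
move=> ndu.
case: (@arg_minnP _ i0 (fun i => u i == u i0) (@nat_of_ord n) (eqxx _)).
move=> a /eqP ua amin.
case: (@arg_maxnP _ i0 (fun i => u i == u i0) (@nat_of_ord n) (eqxx _)).
move=> b /eqP ub bmax.
exists a, b => i; apply/idP/andP => [ui|[ai ib]].
  by split; [exact: amin|exact: bmax].
by rewrite eq_le -{1}ub -ua !ndu.
Qed.

Lemma sum_over_levels u (F : 'I_n -> R) :
  \sum_i F i =
  \sum_(c <- undup [seq u i | i <- enum 'I_n]) \sum_(i | u i == c) F i.
Proof.
under [RHS]eq_bigr do rewrite big_mkcond.
rewrite exchange_big/=; apply: eq_bigr => i _.
rewrite (bigD1_seq (u i)) ?undup_uniq//=; last first.
  by rewrite mem_undup map_f// mem_enum.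
by rewrite eqxx big1 ?addr0// => c; rewrite eq_sym => /negbTE ->.
Qed.

End isotonic_projection.

(* Writing [b] for the mean of [mu] over [A], the fit splits orthogonally as
   [c - mu i = (c - b) - (mu i - b)]: the first part is the mean of the noise, and
   the second one has squared norm at most minus its inner product with the noise. *)
Lemma level_error_le {R : realType} (I : finType) (A : pred I) (mu xi : I -> R)
  (c s1 s2 : R) (m := \sum_(i | A i) 1 : R) (b := (\sum_(i | A i) mu i) / m) :
  0 < m -> 0 <= s2 ->
  \sum_(i | A i) (mu i + xi i - c) = 0 ->
  \sum_(i | A i) (mu i + xi i - c) * mu i <= 0 ->
  (\sum_(i | A i) xi i) ^+ 2 <= s1 * m ->
  (\sum_(i | A i) (mu i - b) * xi i) ^+ 2 <= s2 * \sum_(i | A i) (mu i - b) ^+ 2 ->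
  \sum_(i | A i) (c - mu i) ^+ 2 <= s1 + s2.
Proof.
move=> m0 s20.
pose M := \sum_(i | A i) mu i; pose X := \sum_(i | A i) xi i.
pose K := \sum_(i | A i) mu i ^+ 2; pose Z := \sum_(i | A i) mu i * xi i.
have cst_sum (r : R) : \sum_(i | A i) r = r * m.
  by rewrite /m mulr_sumr; under [RHS]eq_bigr do rewrite mulr1.
have -> : \sum_(i | A i) (mu i + xi i - c) = M + X - c * m.
  by rewrite sumrB big_split/= cst_sum.
have -> : \sum_(i | A i) (mu i + xi i - c) * mu i = K + Z - c * M.
  rewrite /K /Z /M mulr_sumr -big_split -sumrB/=.
  by apply: eq_bigr => i _; ring.
have -> : \sum_(i | A i) (mu i - b) * xi i = Z - b * X.
  by rewrite /Z /X mulr_sumr -sumrB; apply: eq_bigr => i _; ring.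
have sqE (r : R) : \sum_(i | A i) (mu i - r) ^+ 2 = K - 2 * r * M + r ^+ 2 * m.
  rewrite /K /M mulr_sumr -cst_sum -sumrB -big_split/=.
  by apply: eq_bigr => i _; ring.
have -> : \sum_(i | A i) (c - mu i) ^+ 2 = \sum_(i | A i) (mu i - c) ^+ 2.
  by apply: eq_bigr => i _; ring.
have D0 : 0 <= \sum_(i | A i) (mu i - b) ^+ 2.
  by apply: sumr_ge0 => i _; exact: sqr_ge0.
move: D0; rewrite !sqE -/X.
have ME : M = b * m by rewrite /b divfK// gt_eqF.
rewrite ME.
set D := K - 2 * b * (b * m) + b ^+ 2 * m => D0 H1 H2 E1 E2.
have XE : X = (c - b) * m by lra.
(* Here [D] is at most the modulus of a form whose square is at most [s2 * D]; hence
   [D ^+ 2 <= s2 * D], and one divides by [D] unless it is zero. *)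
have Ds2 : D <= s2.
  have DW : D <= - (Z - b * X) by rewrite /D XE; lra.
  have [->//|Dn0] := eqVneq D 0.
  have Dgt0 : 0 < D by rewrite lt_neqAle eq_sym Dn0.
  rewrite -(ler_pM2r Dgt0); apply: le_trans E2.
  by rewrite -expr2 -[leRHS]sqrrN ler_sqr ?nnegrE// (le_trans D0).
have Xs1 : (c - b) ^+ 2 * m <= s1.
  rewrite -(ler_pM2r m0); apply: le_trans E1; rewrite XE.
  by rewrite exprMn [m ^+ 2]expr2 mulrA.
have -> : K - 2 * c * (b * m) + c ^+ 2 * m = (c - b) ^+ 2 * m + D.
  by rewrite /D; ring.
exact: lerD.
Qed.

Lemma measure_bigsetU_le {R : realType} {d : measure_display} {T : measurableType d}
  (P : {measure set T -> \bar R}) (I : Type) (s : seq I) (A : I -> set T) :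
  (forall i, measurable (A i)) ->
  (P (\big[setU/set0]_(i <- s) A i) <= \sum_(i <- s) P (A i))%E.
Proof.
move=> mA; elim: s => [|i s IHs]; first by rewrite !big_nil measure0.
rewrite !big_cons; apply: (le_trans (measureU2 _ _ _)) => //.
  exact: bigsetU_measurable.
exact: leeD.
Qed.

(** * The two linear forms of an interval and the deterministic error bound *)

Section interval_weights.
Context {R : realType} {n : nat} (mu : 'I_n -> R).

(** Pairs with [b < a] are allowed: the interval is empty, both coefficient vectors below vanish,
    and such pairs give empty bad events. *)
Definition interval_len (a b : 'I_n) : R := \sum_(i < n | (a <= i <= b)%N) 1.

Definition interval_mean (a b : 'I_n) : R :=
  (\sum_(i < n | (a <= i <= b)%N) mu i) / interval_len a b.

Definition interval_weight (a b i : 'I_n) : R :=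
  if (a <= i <= b)%N then 1 else 0.

Definition interval_deviation (a b i : 'I_n) : R :=
  if (a <= i <= b)%N then mu i - interval_mean a b else 0.

Lemma interval_deviation_n1 a b i : n = 1%N -> interval_deviation a b i = 0.
Proof.
move=> n1; rewrite /interval_deviation; case: ifP => // ai.
have ord_eq (j k : 'I_n) : j = k.
  apply/val_inj => /=; case: j k => [j +] [k +] /=.
  by rewrite n1 !ltnS !leqn0 => /eqP-> /eqP->.
rewrite /interval_mean /interval_len !(big_pred1 i) ?divr1 ?subrr//.
all: by move=> j; rewrite (ord_eq j i) ai pred1E eqxx.
Qed.

Lemma sum_interval_weight a b (x : 'I_n -> R) :
  \sum_i interval_weight a b i * x i = \sum_(i < n | (a <= i <= b)%N) x i.
Proof.
rewrite [RHS]big_mkcond; apply: eq_bigr => i _; rewrite /interval_weight.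
by case: ifP; rewrite ?mul1r ?mul0r.
Qed.

Lemma sum_interval_weight_sqr a b :
  \sum_i interval_weight a b i ^+ 2 = interval_len a b.
Proof.
rewrite /interval_len [RHS]big_mkcond; apply: eq_bigr => i _.
by rewrite /interval_weight; case: ifP; rewrite ?expr1n ?expr0n.
Qed.

Lemma sum_interval_deviation a b (x : 'I_n -> R) :
  \sum_i interval_deviation a b i * x i =
  \sum_(i < n | (a <= i <= b)%N) (mu i - interval_mean a b) * x i.
Proof.
rewrite [RHS]big_mkcond; apply: eq_bigr => i _; rewrite /interval_deviation.
by case: ifP; rewrite ?mul0r.
Qed.

Lemma sum_interval_deviation_sqr a b :
  \sum_i interval_deviation a b i ^+ 2 =
  \sum_(i < n | (a <= i <= b)%N) (mu i - interval_mean a b) ^+ 2.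
Proof.
rewrite [RHS]big_mkcond; apply: eq_bigr => i _; rewrite /interval_deviation.
by case: ifP; rewrite ?expr0n.
Qed.

(** Each level of [u] contributes at most [s1 + s2]. The bounds on the noise are asked for all
    intervals, since the levels of [u] depend on the noise. *)
Lemma iso_proj_error_le (xi u : 'I_n -> R) (s1 s2 : R) :
  nondecr mu -> is_iso_proj (fun i => mu i + xi i) u -> 0 <= s2 ->
  (forall a b, (\sum_i interval_weight a b i * xi i) ^+ 2 <=
     s1 * \sum_i interval_weight a b i ^+ 2) ->
  (forall a b, (\sum_i interval_deviation a b i * xi i) ^+ 2 <=
     s2 * \sum_i interval_deviation a b i ^+ 2) ->
  \sum_i (u i - mu i) ^+ 2 <= (nb_distinct u)%:R * (s1 + s2).
Proof.
move=> ndmu proju s20 E1 E2; rewrite (sum_over_levels u) /nb_distinct.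
set cs := undup _.
have -> : (size cs)%:R * (s1 + s2) = \sum_(c <- cs) (s1 + s2).
  by rewrite big_const_seq count_predT iter_addr_0 mulr_natl.
rewrite !big_seq; apply: ler_sum => c.
rewrite mem_undup => /mapP[i0 _ ->{c}].
have level_le w : nondecr w -> \sum_(i | u i == u i0) (mu i + xi i - u i0) * w i <= 0.
  exact: iso_proj_level_le0.
(* The constants 1 and -1 are both nondecreasing directions, so the inequality becomes an
   equality. *)
have level0 : \sum_(i | u i == u i0) (mu i + xi i - u i0) = 0.
  apply/le_anti/andP; split.
    by have := level_le (fun=> 1) (fun _ _ _ => lexx _); under eq_bigr do rewrite mulr1.
  have := level_le (fun=> - 1) (fun _ _ _ => lexx _).
  by under eq_bigr do rewrite mulrN1; rewrite sumrN oppr_le0.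
have level_mu := level_le mu ndmu.
have [a [b lev]] := nondecr_level_interval i0 proju.1.
under eq_bigr => i /eqP -> do over.
move: level0 level_mu; rewrite !(eq_bigl _ _ lev) => level0 level_mu.
apply: (level_error_le (xi := xi)) => //.
- rewrite (bigD1 i0) -?lev//= ltr_pwDl// sumr_ge0//.
- by have := E1 a b; rewrite sum_interval_weight sum_interval_weight_sqr.
- by have := E2 a b; rewrite sum_interval_deviation sum_interval_deviation_sqr.
Qed.

End interval_weights.

(** * Choice of the thresholds and union bound over the intervals *)

Unset Implicit Arguments.

Theorem mainTheorem1 (R : realType) (d : measure_display) (T : measurableType d)
  (P : probability T R) (n : nat) (hn : (0 < n)%N)
  (sigma : R) (hsigma : 0 < sigma) (alpha : R) (halpha0 : 0 < alpha) (halpha1 : alpha < 1)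
  (mu : 'I_n -> R) (hmu : nondecr mu)
  (xi : 'I_n -> {RV P >-> R})
  (hindep : mutually_independent P (fun i => (xi i : T -> R)))
  (hgauss : forall i, has_normal_law P (xi i) 0 sigma)
  (muhat : T -> 'I_n -> R)
  (hmuhat : forall w, is_iso_proj (fun i => mu i + xi i w) (muhat w)) :
  exists E : set T, measurable E /\ ((1 - alpha)%:E <= P E)%E /\
    forall w, E w ->
      n%:R^-1 * (\sum_(i < n) (muhat w i - mu i) ^+ 2)
      <= sigma ^+ 2 * (nb_distinct (muhat w))%:R
           * (2 + 22 * ln n%:R + 10 * ln (alpha^-1)) / n%:R.
Proof.
pose X i : T -> R := xi i.
have mX i : measurable_fun [set: T] (X i) by exact: measurable_funPT.
have n1 : 1 <= n%:R :> R by rewrite ler1n.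
have n0 : 0 < n%:R :> R by rewrite ltr0n.
pose l : R := ln n%:R; pose L : R := ln alpha^-1.
have l0 : 0 <= l by exact: ln_ge0.
have L0 : 0 <= L by rewrite ln_ge0// invf_ge1// ltW.
(* The sum [s1 + s2] is exactly the factor [2 + 22 * l + 10 * L] of the claim. *)
pose s2 := 11 * l + 5 * L; pose s1 := 2 + s2.
have s20 : 0 <= s2 by rewrite addr_ge0 ?mulr_ge0.
pose bad u (e : 'I_n -> R) :=
  [set w | u * sigma ^+ 2 * (\sum_i e i ^+ 2) < (\sum_i e i * X i w) ^+ 2].
have mbad u e : measurable (bad u e) by exact: measurable_linear_form_sqr_gt.
have bad_le u e : (P (bad u e) <= (2 * expR (- (u / 2)))%:E)%E.
  exact: gaussian_linear_form_tail.
pose badI (p : 'I_n * 'I_n) :=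
  bad s1 (interval_weight p.1 p.2) `|` bad s2 (interval_deviation mu p.1 p.2).
have mbadI p : measurable (badI p) by exact: measurableU.
(* This is [alpha / n ^ 4]: each of the [n ^ 2] pairs may fail with probability [n ^ 2 * q]. *)
pose q := expR (- (4 * l + L)).
have qE : q = n%:R ^- 4 * alpha.
  rewrite /q opprD expRD !expRN expRM_natl lnK ?posrE// lnK ?posrE ?invr_gt0//.
  by rewrite invrK.
have s2q : expR (- (s2 / 2)) <= q by rewrite ler_expR /s2; lra.
(* The extra 2 in [s1] yields a factor [expR (- 1)], at most 1/2, which absorbs the 2 of the
   two-sided tail. *)
have s1q : 2 * expR (- (s1 / 2)) <= q.
  have -> : - (s1 / 2) = - 1 + - (s2 / 2) by rewrite /s1; lra.
  rewrite expRD mulrA (le_trans _ s2q)// ler_piMl ?expR_ge0//.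
  by rewrite expRN ler_pdivrMr ?expR_gt0// mul1r (le_trans _ (expR_ge1Dx 1)).
(* On a single point every interval deviation vanishes, so the second kind of bad
   event costs nothing when [n = 1]; hence the factor [n - 1]. *)
have bad2 p : (P (bad s2 (interval_deviation mu p.1 p.2)) <=
    ((n%:R - 1) * (2 * q))%:E)%E.
  have [n_eq1|n_neq1] := eqVneq n 1%N.
    rewrite [Y in P Y](_ : _ = set0) ?measure0 ?lee_fin.
      by rewrite !mulr_ge0 ?subr_ge0 ?expR_ge0.
    apply/seteqP; split => // w; rewrite /bad/= !big1 ?expr0n ?mulr0 ?ltxx//.
      by move=> i _; rewrite interval_deviation_n1// mul0r.
    by move=> i _; rewrite interval_deviation_n1// expr0n.
  apply: (le_trans (bad_le _ _)); rewrite lee_fin.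
  have n2 : 2 <= n%:R :> R by rewrite ler_nat ltn_neqAle eq_sym n_neq1.
  have q0 : 0 <= q by exact: expR_ge0.
  have : 0 <= (n%:R - 2) * q by rewrite mulr_ge0// subr_ge0.
  rewrite mulrBl; lra.
have badI_le p : (P (badI p) <= (n%:R ^+ 2 * q)%:E)%E.
  apply: (le_trans (measureU2 _ _ _)) => //.
  apply: (le_trans (leeD (bad_le _ _) (bad2 p))); rewrite -EFinD lee_fin.
  have q0 : 0 <= q by exact: expR_ge0.
  apply: (le_trans (lerD s1q (lexx _))).
  (* The two bounds add up to [(2 * n - 1) * q], and [2 * n - 1 <= n ^ 2]. *)
  have : 0 <= (n%:R - 1) ^+ 2 * q by rewrite mulr_ge0 ?sqr_ge0.
  rewrite sqrrB expr1n mulr1; lra.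
pose B := \big[setU/set0]_(p : 'I_n * 'I_n) badI p.
have mB : measurable B by exact: bigsetU_measurable.
exists (~` B); split; first exact: measurableC.
split=> [|w Bw].
  rewrite probability_setC// EFinB leeB//.
  apply: (le_trans (measure_bigsetU_le _ _ _)) => //.
  apply: (le_trans (lee_sum _ (fun p _ => badI_le p))).
  rewrite sumEFin lee_fin sumr_const card_prod card_ord -[leLHS]mulr_natr natrM qE.
  (* The total [n ^ 2 * (n ^ 2 * q)] equals [alpha]. *)
  by rewrite le_eqVlt; apply/orP; left; apply/eqP; field; rewrite gt_eqF.
have notbad p : ~ badI p w.
  move=> bp; apply: Bw; rewrite /B -bigcup_seq; exists p => //=.
  exact: mem_index_enum.
have err : \sum_i (muhat w i - mu i) ^+ 2 <=
    (nb_distinct (muhat w))%:R * (s1 * sigma ^+ 2 + s2 * sigma ^+ 2).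
  apply: (iso_proj_error_le hmu (hmuhat w)) => [|a b|a b].
  - by rewrite mulr_ge0 ?sqr_ge0.
  - by rewrite leNgt; apply/negP => h; apply: (notbad (a, b)); left.
  - by rewrite leNgt; apply/negP => h; apply: (notbad (a, b)); right.
rewrite mulrC ler_pM2r ?invr_gt0//; apply: (le_trans err).
rewrite le_eqVlt; apply/orP; left; apply/eqP.
by rewrite /s1 /s2 -/l -/L; ring.
Qed.
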